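(* Let $u:\mathbb{T}^d\to\mathbb{R}$ be a semiconcave function and let $x\in\mathbb{T}^d$. Then for any $\varepsilon>0$ $$\lim_{T\to\infty}\frac1T\,\mathcal{L}^1\Big(\big\{t\in[0,T]: d_{\mathrm{Crit}(u)}\big(\mathbf{x}_u(t,x)\big)\geq\varepsilon\big\}\Big)=0 .$$
   Context: $\mathbb{T}^d=\mathbb{R}^d/\mathbb{Z}^d$ is the flat torus; functions on $\mathbb{T}^d$ are identified with their $\mathbb{Z}^d$-periodic extensions to $\mathbb{R}^d$. A continuous $u:\mathbb{T}^d\to\mathbb{R}$ is semiconcave if there is $C>0$ (a semiconcavity constant) with $\lambda u(x)+(1-\lambda)u(y)-u(\lambda x+(1-\lambda)y)\le \frac C2\lambda(1-\lambda)|x-y|^2$ for all $x,y$ and $\lambda\in[0,1]$. The superdifferential is $D^+u(x)=\{p\in\mathbb{R}^d:\limsup_{y\to x}\frac{u(y)-u(x)-\langle p,y-x\rangle}{|y-x|}\le0\}$; for semiconcave $u$ it is nonempty, convex and compact at every point. The critical set is $\mathrm{Crit}(u)=\{x\in\mathbb{T}^d:0\in D^+u(x)\}$, which is nonempty and closed. The generalized gradient flow $\mathbf{x}_u(\cdot,x):[0,\infty)\to\mathbb{T}^d$ is the unique locally Lipschitz solution of $\dot{\mathbf{x}}(t)\in D^+u(\mathbf{x}(t))$ for a.e. $t\ge0$, $\mathbf{x}(0)=x$. $d_S(y)$ is the (flat, Euclidean) distance of $y\in\mathbb{T}^d$ from the closed set $S$, and $\mathcal{L}^1$ is one-dimensional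 Lebesgue measure. *)

(* Defs.v *)
From HB Require Import structures.
From mathcomp Require Import all_boot all_order all_algebra.
From mathcomp Require Import all_classical all_reals all_analysis.
Import Order.TTheory GRing.Theory Num.Theory.
Import numFieldNormedType.Exports.

Set Implicit Arguments.
Unset Strict Implicit.
Unset Printing Implicit Defensive.

Local Open Scope classical_set_scope.
Local Open Scope ring_scope.
Local Open Scope quotient_scope.

(* The library norm `|v| on row vectors is the sup norm; it induces the same
   topology and the same derivatives of curves as [enorm]. *)
Definition enorm (R : realType) (d : nat) (v : 'rV[R]_d) : R :=
  Num.sqrt (\sum_(i < d) v ord0 i ^+ 2).

Definition dotv (R : realType) (d : nat) (v w : 'rV[R]_d) : R :=
  \sum_(i < d) v ord0 i * w ord0 i.

Definition int_lattice (R : realType) (d : nat) : {pred 'rV[R]_d} :=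
  fun v => [forall i, v ord0 i \is a Num.int].
Arguments int_lattice : clear implicits.

Fact int_lattice_zmod_closed (R : realType) (d : nat) :
  zmod_closed (int_lattice R d).
Proof.
split=> [|v w /forallP vP /forallP wP]; apply/forallP => i.
- by rewrite mxE rpred0.
- by rewrite !mxE rpredB.
Qed.

HB.instance Definition _ (R : realType) (d : nat) :=
  GRing.isZmodClosed.Build _ (int_lattice R d)
    (@int_lattice_zmod_closed R d).

(* R^d / Z^d with the quotient topology. *)
Definition torus (R : realType) (d : nat) : Type :=
  quotient_topology (Quotient.quot (int_lattice R d)).

HB.instance Definition _ (R : realType) (d : nat) :=
  Topological.on (torus R d).
HB.instance Definition _ (R : realType) (d : nat) :=
  Quotient.on (torus R d).

Definition toT (R : realType) (d : nat) (v : 'rV[R]_d) : torus R d :=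
  \pi_(torus R d) v.

Definition torus_dist (R : realType) (d : nat) (x y : torus R d) : R :=
  inf [set enorm (v - w) | v in [set v | toT v = x] & w in [set w | toT w = y]].

(* For S = set0 the value is the junk value 0; the critical set of a semiconcave
   function is nonempty (it contains the maximum points). *)
Definition dist_set (R : realType) (d : nat) (S : set (torus R d))
    (y : torus R d) : R :=
  inf [set torus_dist y z | z in S].

Definition periodic_ext (R : realType) (d : nat) (u : torus R d -> R)
    (v : 'rV[R]_d) : R :=
  u (toT v).

Definition semiconcave (R : realType) (d : nat) (u : torus R d -> R) : Prop :=
  continuous u /\
  exists2 C : R, 0 < C &
    forall (v w : 'rV[R]_d) (l : R), 0 <= l <= 1 ->
      l * periodic_ext u v + (1 - l) * periodic_ext u w
        - periodic_ext u (l *: v + (1 - l) *: w)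
      <= C / 2 * (l * (1 - l)) * enorm (v - w) ^+ 2.

Definition superdiff_ext (R : realType) (d : nat) (f : 'rV[R]_d -> R)
    (v : 'rV[R]_d) : set 'rV[R]_d :=
  [set p | (limf_esup
     (fun w => ((f w - f v - dotv p (w - v)) / enorm (w - v))%:E) (v^')
     <= 0)%E].

(* By periodicity the set does not depend on the representative of x. *)
Definition superdiff (R : realType) (d : nat) (u : torus R d -> R)
    (x : torus R d) : set 'rV[R]_d :=
  superdiff_ext (periodic_ext u) (repr x).

Definition Crit (R : realType) (d : nat) (u : torus R d -> R) :
    set (torus R d) :=
  [set x | superdiff u x 0].

(* Tangent vectors of the torus are vectors of R^d: the velocity of a curve is
   the derivative of a local lift. *)
Definition has_velocity (R : realType) (d : nat) (c : R -> torus R d) (t : R)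
    (p : 'rV[R]_d) : Prop :=
  exists2 g : R -> 'rV[R]_d,
    (\forall s \near t, toT (g s) = c s) & is_derive t 1 g p.

Definition locally_lipschitz (R : realType) (d : nat) (c : R -> torus R d) :
    Prop :=
  forall t0 : R, 0 <= t0 ->
    exists delta L : R, 0 < delta /\
      forall s t : R, 0 <= s -> 0 <= t ->
        `|s - t0| < delta -> `|t - t0| < delta ->
        torus_dist (c s) (c t) <= L * `|s - t|.

(* A curve on [0, +oo) is a total function of which only the values at t >= 0
   are used. *)
Definition gradient_flow (R : realType) (d : nat) (u : torus R d -> R)
    (x : torus R d) (c : R -> torus R d) : Prop :=
  [/\ c 0 = x,
      locally_lipschitz c &
      {ae @lebesgue_measure R, forall t : R, 0 <= t ->
         exists2 p, superdiff u (c t) p & has_velocity c t p}].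

(* Main.v *)
Require Import Defs.
From mathcomp Require Import all_boot all_order all_algebra.
From mathcomp Require Import all_classical all_reals all_analysis.
From mathcomp Require Import measurable_realfun ring lra.
Import Order.TTheory GRing.Theory Num.Theory.
Import numFieldNormedType.Exports.

(** Along the flow [u] is nondecreasing and gains height at the rate of the
squared speed, while [u] is bounded on the torus; far from the critical set the
speed is bounded below.  Hence the total time spent at distance at least [eps]
from [Crit u] is finite, bounded independently of [T]
([far_times_bounded]), and the average tends to [0].

Two facts carry this.

- The speed bound ([superdiff_away_Crit]).  For a semiconcave function a
  superdifferential element gives a global upper bound by a paraboloid whose
  opening [C] does not depend on the point ([superdiff_le]).  Such a bound with
  [p = 0] characterizes critical points, and the failure of the bound at a
  noncritical point is an open condition on the pair formed by the point and a
  small [p].  Compactness of the unit cube gives one [delta] for all points at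
  distance at least [eps] from [Crit u].

- The gain of height ([dini_occupation_le]).  Where the velocity [p] exists
  and belongs to the superdifferential, evaluating the paraboloid bound at
  slightly earlier times gives
  [u (c t) - u (c s) >= (|p|^2 - e) (t - s)] for [s < t] close to [t]
  ([energy_left]): a lower bound for the left Dini derivative of [u o c].  It
  holds for almost every [t], and is integrated by a monotonicity argument.  The
  exceptional null set is covered by an open set [U] of small measure, and [u o c] is
  corrected by a multiple of the time spent in [U], which compensates its
  possible decrease there since it is Lipschitz.  After subtracting [delta^2]
  times the time spent in the closed set of far times and adding a small linear
  term, the result cannot decrease to the left of any point, so it is monotone
  ([left_monotone_le]). *)

Set Implicit Arguments.
Unset Strict Implicit.
Unset Printing Implicit Defensive.

Local Open Scope classical_set_scope.
Local Open Scope ring_scope.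

(** * The Euclidean norm on row vectors *)

Section Euclidean.
Variables (R : realType) (d : nat).
Implicit Types (v w p : 'rV[R]_d) (a : R).

Lemma dotvC v w : dotv v w = dotv w v.
Proof. by apply: eq_bigr => i _; rewrite mulrC. Qed.

Lemma dotvDl v w p : dotv (v + w) p = dotv v p + dotv w p.
Proof. by rewrite -big_split; apply: eq_bigr => i _; rewrite mxE mulrDl. Qed.

Lemma dotvZl a v w : dotv (a *: v) w = a * dotv v w.
Proof. by rewrite mulr_sumr; apply: eq_bigr => i _; rewrite mxE mulrA. Qed.

Lemma dotvDr v w p : dotv p (v + w) = dotv p v + dotv p w.
Proof. by rewrite dotvC dotvDl !(dotvC _ p). Qed.

Lemma dotvZr a v w : dotv w (a *: v) = a * dotv w v.
Proof. by rewrite dotvC dotvZl dotvC. Qed.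

Lemma dot0v v : dotv 0 v = 0.
Proof. by rewrite -(scale0r v) dotvZl mul0r. Qed.

Lemma enorm_ge0 v : 0 <= enorm v.
Proof. exact: sqrtr_ge0. Qed.

Lemma sqr_enorm v : enorm v ^+ 2 = dotv v v.
Proof.
rewrite sqr_sqrtr; last by apply: sumr_ge0 => i _; exact: sqr_ge0.
by apply: eq_bigr => i _; rewrite expr2.
Qed.

Lemma enormZ a v : enorm (a *: v) = `|a| * enorm v.
Proof.
apply/eqP; rewrite -(eqrXn2 (n := 2)) ?mulr_ge0 ?enorm_ge0 ?normr_ge0//.
by rewrite exprMn !sqr_enorm dotvZl dotvZr real_normK ?num_real// expr2 mulrA.
Qed.

Lemma enormN v : enorm (- v) = enorm v.
Proof. by rewrite -scaleN1r enormZ normrN1 mul1r. Qed.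

Lemma enormB v w : enorm (v - w) = enorm (w - v).
Proof. by rewrite -enormN opprB. Qed.

Lemma enorm0 : enorm (0 : 'rV[R]_d) = 0.
Proof. by rewrite -(scale0r 0) enormZ normr0 mul0r. Qed.

Lemma enorm0_eq0 v : enorm v = 0 -> v = 0.
Proof.
move=> v0; apply/rowP => i; rewrite mxE; apply/eqP.
have : dotv v v == 0 by rewrite -sqr_enorm v0 expr0n.
rewrite psumr_eq0; last by move=> j _; rewrite -expr2 sqr_ge0.
by move/allP/(_ i); rewrite mem_index_enum -expr2 sqrf_eq0 => /(_ isT).
Qed.

(** Cauchy-Schwarz, from the nonnegativity of the square of
    [enorm w *: v - enorm v *: w]. *)
Lemma dotv_le v w : dotv v w <= enorm v * enorm w.
Proof.
have [/enorm0_eq0 ->|v0] := eqVneq (enorm v) 0.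
  by rewrite dot0v enorm0 mul0r.
have [/enorm0_eq0 ->|w0] := eqVneq (enorm w) 0.
  by rewrite dotvC dot0v enorm0 mulr0.
have vw0 : 0 < enorm v * enorm w by rewrite mulr_gt0// lt_neqAle eq_sym enorm_ge0 andbT.
have := sqr_ge0 (enorm (enorm w *: v + (- enorm v) *: w)).
rewrite sqr_enorm dotvDl !dotvDr !dotvZl !dotvZr -!sqr_enorm (dotvC w v) => h.
have {h} : 0 <= (enorm v * enorm w) * (enorm v * enorm w - dotv v w) by nra.
by rewrite pmulr_rge0// subr_ge0.
Qed.

Lemma ler_enormD v w : enorm (v + w) <= enorm v + enorm w.
Proof.
rewrite -(ler_pXn2r (n := 2)) ?nnegrE ?addr_ge0 ?enorm_ge0//.
rewrite sqr_enorm dotvDl !dotvDr sqrrD !sqr_enorm (dotvC w v).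
by have := dotv_le v w; lra.
Qed.

(** Comparison with the sup norm, which is the one defining neighborhoods. *)
Lemma ler_enorm_norm v : enorm v <= d%:R * `|v|.
Proof.
rewrite -(ler_pXn2r (n := 2)) ?nnegrE ?mulr_ge0 ?enorm_ge0 ?normr_ge0//.
rewrite sqr_enorm.
apply: (@le_trans _ _ (\sum_(i < d) `|v| ^+ 2)).
  apply: ler_sum => i _; rewrite -expr2 -real_normK ?num_real// ler_pXn2r ?nnegrE//.
  by rewrite [`|v|]mx_normrE (le_trans _ (le_bigmax _ _ (ord0, i))).
rewrite sumr_const card_ord -[leLHS]mulr_natl exprMn ler_wpM2r ?sqr_ge0//.
by rewrite -natrX ler_nat; case: (d) => // n; rewrite expnS leq_pmulr// expn_gt0.
Qed.

Lemma near_enorm_lt v e : 0 < e -> \forall w \near nbhs (v : 'rV[R]_d), enorm (w - v) < e.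
Proof.
move=> e0; have r0 : 0 < e / (d%:R + 1) by rewrite divr_gt0// ltr_wpDl.
near=> w; apply: (le_lt_trans (ler_enorm_norm _)).
have : ball v (e / (d%:R + 1)) w by near: w; exact: nbhsx_ballx.
rewrite -ball_normE/= distrC ltr_pdivlMr ?ltr_wpDl// mulrC.
by apply: le_lt_trans; rewrite ler_wpM2r// lerDl.
Unshelve. all: by end_near. Qed.

Lemma enormB_continuous w : continuous (fun v => enorm (w - v)).
Proof.
move=> v; apply: (@cvgrPdist_lt _ _ _ _ (nbhs_filter v) _ _).2 => e e0; near=> z.
have zv : enorm (z - v) < e by near: z; exact: near_enorm_lt.
have := ler_enormD (w - z) (z - v); have := ler_enormD (w - v) (v - z).
rewrite !addrA !subrK (enormB v z) ltr_norml => h1 h2.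
by apply/andP; split; lra.
Unshelve. all: by end_near. Qed.

End Euclidean.

(** * The flat distance on the torus *)

Section Torus.
Variables (R : realType) (d : nat).
Implicit Types (v w : 'rV[R]_d) (x y z : torus R d) (S : set (torus R d)).

Lemma toT_eq v w : (toT v = toT w) <-> v - w \in int_lattice R d.
Proof.
rewrite (Quotient.idealrBE (int_lattice R d)); split => [|/eqP//].
by move=> h; apply/eqP.
Qed.

Lemma toT_repr x : toT (repr x) = x.
Proof. exact: reprK. Qed.

(** Representatives in a fixed compact set: every compactness argument on the
    torus goes through this. *)
Lemma toT_cube x : exists2 v, toT v = x & forall i, 0 <= v ord0 i <= 1.
Proof.
pose w := repr x.
exists (\row_i (w ord0 i - (Num.floor (w ord0 i))%:~R)).
  rewrite -(toT_repr x); apply/toT_eq/forallP => i.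
  by rewrite !mxE addrAC subrr add0r rpredN intr_int.
by move=> i; rewrite mxE subr_ge0 ge_floor/= lerBlDr addrC -intrD1 ltW// floorD1_gt.
Qed.

Lemma torus_dist_le v w : torus_dist (toT v) (toT w) <= enorm (v - w).
Proof.
apply: ge_inf; first by exists 0 => _ [? _ [? _ <-]]; exact: enorm_ge0.
by exists v => //; exists w.
Qed.

Lemma torus_dist_adherent x y e : 0 < e ->
  exists v w, [/\ toT v = x, toT w = y & enorm (v - w) < torus_dist x y + e].
Proof.
move=> e0; have : has_inf
   [set enorm (v - w) | v in [set v | toT v = x] & w in [set w | toT w = y]].
  split; last by exists 0 => _ [? _ [? _ <-]]; exact: enorm_ge0.
  exists (enorm (repr x - repr y)); exists (repr x); first exact: toT_repr.
  by exists (repr y) => //; exact: toT_repr.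
by move=> /(inf_adherent e0)[_ [v vx [w wy <-]] h]; exists v, w.
Qed.

Lemma torus_dist_ge0 x y : 0 <= torus_dist x y.
Proof.
apply: lb_le_inf => [|_ [? _ [? _ <-]]]; last exact: enorm_ge0.
exists (enorm (repr x - repr y)); exists (repr x); first exact: toT_repr.
by exists (repr y) => //; exact: toT_repr.
Qed.

Lemma torus_distC x y : torus_dist x y = torus_dist y x.
Proof.
by congr inf; apply/seteqP; split => _ [v vx [w wy <-]];
  exists w => //; exists v => //; rewrite enormB.
Qed.

(** Near-optimal representatives of the two distances share the middle point
    only up to a lattice vector; translating one pair by it makes them meet. *)
Lemma torus_dist_triangle x y z : torus_dist x z <= torus_dist x y + torus_dist y z.
Proof.
apply/ler_addgt0Pr => e e0.
have e20 : 0 < e / 2 by rewrite divr_gt0.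
have [v [w [vx wy vw]]] := torus_dist_adherent x y e20.
have [w' [s [wy' sz ws]]] := torus_dist_adherent y z e20.
have sz' : toT (s + (w - w')) = z.
  by rewrite -sz; apply/toT_eq; rewrite addrAC subrr add0r; apply/toT_eq; rewrite wy wy'.
rewrite -vx -sz'; apply: (le_trans (torus_dist_le _ _)).
have -> : v - (s + (w - w')) = (v - w) + (w' - s).
  by apply/rowP => i; rewrite !mxE; ring.
rewrite vx sz'.
apply: (le_trans (ler_enormD _ _)); lra.
Qed.

Lemma dist_set_le S y z : S z -> dist_set S y <= torus_dist y z.
Proof.
move=> Sz; apply: ge_inf; last by exists z.
by exists 0 => _ [? _ <-]; exact: torus_dist_ge0.
Qed.

Lemma dist_set_lip S y z : dist_set S y <= torus_dist y z + dist_set S z.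
Proof.
have [->|/set0P S0] := eqVneq S set0.
  by rewrite /dist_set !image_set0 inf0 addr0 torus_dist_ge0.
rewrite -lerBlDl; apply: lb_le_inf => [|_ [s Ss <-]]; first exact: image_nonempty.
rewrite lerBlDl; apply: (le_trans (dist_set_le y Ss)).
exact: torus_dist_triangle.
Qed.

End Torus.

(** * Superdifferentials of semiconcave functions *)

Section Semiconcave.
Variables (R : realType) (d : nat).
Implicit Types (u : torus R d -> R) (v w p : 'rV[R]_d).

Definition semiconcave_with (C : R) u : Prop :=
  forall v w (l : R), 0 <= l <= 1 ->
    l * periodic_ext u v + (1 - l) * periodic_ext u w
      - periodic_ext u (l *: v + (1 - l) *: w)
    <= C / 2 * (l * (1 - l)) * enorm (v - w) ^+ 2.

Lemma periodic_ext_continuous u : continuous u -> continuous (periodic_ext u).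
Proof.
move=> uc v; apply: (@continuous_comp _ _ _ (@toT R d) u); last exact: uc.
exact: pi_continuous.
Qed.

Lemma compact_cube : compact [set v : 'rV[R]_d | forall i, `[0, 1]%classic (v ord0 i)].
Proof.
by have := @rV_compact R d (fun=> `[0, 1]%classic) (fun=> @segment_compact R 0 1).
Qed.

Lemma torus_bounded u : continuous u -> exists2 M, 0 <= M & forall x, `|u x| <= M.
Proof.
move=> /periodic_ext_continuous fc.
have /compact_bounded[M [_ MP]] :=
  continuous_compact (continuous_subspaceT fc) compact_cube.
exists (`|M| + 1) => [|x]; first by rewrite addr_ge0.
have [v <- v01] := toT_cube x.
apply: (MP (`|M| + 1)); first by rewrite ltr_pwDr// ler_norm.
by exists v => // i; rewrite /= in_itv/= v01.
Qed.

(** A bounded semiconcave function is Lipschitz: for [v] and [w] at distance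
    [r < 1], extend the segment from [v] through [w] to length [1]; the value at
    [w] is then bounded below, up to [C / 2 * r], by the chord, whose slope is at
    most [2 * M] in absolute value. *)
Lemma semiconcave_lip u C M : 0 <= C -> (forall x, `|u x| <= M) -> semiconcave_with C u ->
  forall v w, periodic_ext u v - periodic_ext u w <= (2 * M + C / 2) * enorm (v - w).
Proof.
move=> C0 uM sc v w.
have fM z : - M <= periodic_ext u z <= M by rewrite -ler_norml; exact: uM.
have M0 : 0 <= M by have := fM 0; lra.
have := fM v; have := fM w.
set r := enorm (v - w); have r0 : 0 <= r by exact: enorm_ge0.
have [r1|r1] := lerP 1 r; first by nra.
have [/enorm0_eq0/eqP|rn0] := eqVneq (enorm (v - w)) 0.
  by rewrite subr_eq0 => /eqP ->; nra.
have rp : 0 < r by rewrite lt_neqAle eq_sym rn0.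
pose e := r^-1 *: (w - v).
have := sc (v + e) v r; have := fM (v + e).
have -> : r *: (v + e) + (1 - r) *: v = w.
  rewrite /e scalerDr scalerA mulfV// scale1r scalerBl scale1r.
  by apply/rowP => i; rewrite !mxE; ring.
have -> : v + e - v = e by rewrite addrAC subrr add0r.
have -> : enorm e = 1.
  by rewrite enormZ enormB -/r ger0_norm ?invr_ge0// mulVf.
have -> : 0 <= r <= 1 by rewrite r0 ltW.
by rewrite expr1n => + /(_ isT); nra.
Qed.

Lemma superdiff_ext_near f v p e : superdiff_ext f v p -> 0 < e ->
  \forall w \near v^', f w - f v - dotv p (w - v) <= e * enorm (w - v).
Proof.
rewrite /superdiff_ext/= => h e0.
have /ereal_inf_lt[_ [V Vv <-]] : (limf_esup
     (fun w => ((f w - f v - dotv p (w - v)) / enorm (w - v))%:E) (v^')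
     < e%:E)%E by rewrite (le_lt_trans h)// lte_fin.
move=> Ve; near=> w.
have wv : w != v by near: w; exact: nbhs_dnbhs_neq.
have Vw : V w by near: w.
have : (((f w - f v - dotv p (w - v)) / enorm (w - v))%:E < e%:E)%E.
  by apply: le_lt_trans Ve; apply: ereal_sup_ubound; exists w.
rewrite lte_fin ltr_pdivrMr; first exact: ltW.
rewrite lt_neqAle enorm_ge0 andbT eq_sym; apply: contra wv => /eqP/enorm0_eq0/eqP.
by rewrite subr_eq0.
Unshelve. all: by end_near. Qed.

(** Moving a short way from [v] towards [w], semiconcavity bounds the value from
    below by the chord and the superdifferential bounds it from above. *)
Lemma superdiff_ext_le u C v p : 0 <= C -> semiconcave_with C u ->
  superdiff_ext (periodic_ext u) v p ->
  forall w, periodic_ext u w <=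
    periodic_ext u v + dotv p (w - v) + C / 2 * enorm (w - v) ^+ 2.
Proof.
set f := periodic_ext u => C0 sc vp w.
have [->|wv] := eqVneq w v.
  by rewrite subrr dotvC dot0v enorm0 expr0n/= mulr0 !addr0.
apply/ler_addgt0Pr => e e0.
have r0 : 0 < enorm (w - v).
  rewrite lt_neqAle enorm_ge0 andbT eq_sym; apply: contra wv => /eqP/enorm0_eq0/eqP.
  by rewrite subr_eq0.
(* Small positive steps towards [w] form a filter finer than [v^'], so the
   infinitesimal bound can be evaluated along the segment. *)
have near_v : (v + l *: (w - v)) @[l --> 0^'+] --> v^'.
  move=> V /= vV; rewrite /dnbhs/within/= in vV.
  have cv : (v + l *: (w - v)) @[l --> 0^'+] --> v.
    have : v + l *: (w - v) @[l --> 0^'+] --> v + 0 *: (w - v).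
      apply: cvgD; first exact: cvg_cst.
      by apply: cvgZr_tmp; apply: cvg_at_right_filter; exact: cvg_id.
    by rewrite scale0r addr0.
  have {}vV : \forall l \near 0^'+,
      v + l *: (w - v) != v -> V (v + l *: (w - v)) := cv _ vV.
  change (\forall l \near 0^'+, V (v + l *: (w - v))).
  apply: (@filterS2 _ _ _ _ _ _ _ vV (nbhs_right_gt 0)) => l /= vl l0; apply: vl.
  by rewrite -subr_eq0 addrAC subrr add0r scaler_eq0 negb_or subr_eq0 wv gt_eqF.
have h := near_v _ (superdiff_ext_near vp (divr_gt0 e0 r0)).
have [l [l01 {}h]] : exists l : R, 0 < l < 1 /\
   f (v + l *: (w - v)) - f v - dotv p (v + l *: (w - v) - v) <=
     e / enorm (w - v) * enorm (v + l *: (w - v) - v).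
  have : \forall l \near 0^'+, 0 < l < 1 /\
   f (v + l *: (w - v)) - f v - dotv p (v + l *: (w - v) - v) <=
     e / enorm (w - v) * enorm (v + l *: (w - v) - v).
    near=> l; split; last by near: l; exact: h.
    by apply/andP; split; near: l; [exact: nbhs_right_gt|exact: nbhs_right_lt].
  exact: filter_ex.
have /andP[l0 l1] := l01.
have vlE : v + l *: (w - v) - v = l *: (w - v) by rewrite addrAC subrr add0r.
move: h; rewrite vlE dotvZr enormZ gtr0_norm// mulrCA divfK ?gt_eqF//.
have := sc w v l; rewrite (ltW l0) (ltW l1) => /(_ isT).
have -> : l *: w + (1 - l) *: v = v + l *: (w - v).
  by apply/rowP => i; rewrite !mxE; ring.
rewrite -/f; set fz := f (v + _) => h1 h2.
have Cr : 0 <= C / 2 * enorm (w - v) ^+ 2 by rewrite mulr_ge0 ?sqr_ge0// divr_ge0.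
rewrite -(ler_pM2l l0); nra.
Unshelve. all: by end_near. Qed.

(** A quadratic error is negligible with respect to the distance; the radius
    also absorbs the factor [d] between the Euclidean norm and the sup norm. *)
Lemma superdiff_ext0 f C v : 0 <= C ->
  (forall w, f w <= f v + C / 2 * enorm (w - v) ^+ 2) -> superdiff_ext f v 0.
Proof.
move=> C0 h; apply/lee_addgt0Pr => e e0; rewrite add0e.
have r0 : 0 < e / ((C + 1) * (d%:R + 1)).
  by rewrite divr_gt0// mulr_gt0// ltr_wpDl.
apply: (@le_trans _ _ (ereal_sup [set ((f w - f v - dotv 0 (w - v)) / enorm (w - v))%:E
     | w in ball v (e / ((C + 1) * (d%:R + 1))) `\ v])).
  apply: ereal_inf_lbound; eexists; last by [].
  exact: dnbhs_ball.
apply: ge_ereal_sup => _ [w [+ wv] <-].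
rewrite -ball_normE/= lee_fin dot0v subr0 distrC => wr.
have [->|w0] := eqVneq (enorm (w - v)) 0; first by rewrite invr0 mulr0 ltW.
have {}w0 : 0 < enorm (w - v) by rewrite lt_neqAle eq_sym w0 enorm_ge0.
rewrite ler_pdivrMr//.
apply: (@le_trans _ _ (C / 2 * enorm (w - v) ^+ 2)); first by have := h w; lra.
have [We] : enorm (w - v) * (C + 1) <= e.
  apply: (le_trans (ler_wpM2r _ (ler_enorm_norm _))); first by rewrite addr_ge0.
  move: wr; rewrite ltr_pdivlMr; last by rewrite mulr_gt0// ltr_wpDl.
  have := normr_ge0 (w - v); have : 0 <= d%:R :> R by [].
  by nra.
by nra.
Qed.

(** Unlike the defining limit, the paraboloid bound transfers immediately from
    [repr x] to any other representative of [x]: translate [w]. *)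
Lemma superdiff_le u C v p : 0 <= C -> semiconcave_with C u ->
  superdiff u (toT v) p ->
  forall w, periodic_ext u w <=
    periodic_ext u v + dotv p (w - v) + C / 2 * enorm (w - v) ^+ 2.
Proof.
move=> C0 sc vp w.
have := superdiff_ext_le C0 sc vp (w + (repr (toT v) - v)).
have -> : w + (repr (toT v) - v) - repr (toT v) = w - v.
  by apply/rowP => i; rewrite !mxE; ring.
rewrite /periodic_ext toT_repr.
suff -> : toT (w + (repr (toT v) - v)) = toT w by [].
apply/toT_eq; rewrite addrAC subrr add0r; apply/toT_eq; exact: toT_repr.
Qed.

Lemma Crit_of_le u C v : 0 <= C ->
  (forall w, periodic_ext u w <= periodic_ext u v + C / 2 * enorm (w - v) ^+ 2) ->
  Crit u (toT v).
Proof.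
move=> C0 h; apply: (superdiff_ext0 C0) => w.
have := h (w - (repr (toT v) - v)).
have -> : w - (repr (toT v) - v) - v = w - repr (toT v).
  by apply/rowP => i; rewrite !mxE; ring.
rewrite /periodic_ext toT_repr.
suff -> : toT (w - (repr (toT v) - v)) = toT w by [].
apply/toT_eq; rewrite addrAC subrr add0r -opprB opprK; apply/toT_eq; rewrite toT_repr//.
Qed.

Lemma parabola_continuous u C w : continuous u ->
  continuous (fun v => periodic_ext u v + C / 2 * enorm (w - v) ^+ 2).
Proof.
move=> /periodic_ext_continuous fc v.
have nc := @enormB_continuous R d w v.
exact: (cvgD (fc v) (cvgM (cvg_cst (C / 2)) (cvgM nc nc))).
Qed.

(** The superdifferential bound with a fixed [C] passes to limits, so near a noncritical
    point it has no small elements, and compactness makes this uniform. *)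
Lemma superdiff_away_Crit u C eps : continuous u -> 0 <= C -> semiconcave_with C u ->
  0 < eps ->
  exists2 delta, 0 < delta & forall x p, superdiff u x p ->
    eps <= dist_set (Crit u) x -> delta <= enorm p.
Proof.
move=> uc C0 sc e0; set f := periodic_ext u.
have fc : continuous f by exact: periodic_ext_continuous.
have : \forall delta \near 0^'+, [set v : 'rV[R]_d | forall i, `[0, 1]%classic (v ord0 i)] `<=`
   [set v | forall p, superdiff u (toT v) p -> eps <= dist_set (Crit u) (toT v) ->
      delta <= enorm p].
  have /compact_near_coveringP := compact_cube; apply => v _.
  have [cv|ncv] := pselect (Crit u (toT v)).
    near=> w delta => p _ /=; rewrite leNgt => /negP[].
    apply: (le_lt_trans (dist_set_le _ cv)).
    apply: (le_lt_trans (torus_dist_le _ _)).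
    by near: w; exact: near_enorm_lt.
  have [w wP] : exists w, f v + C / 2 * enorm (w - v) ^+ 2 < f w.
    apply/not_existsP => h; apply: ncv; apply: (Crit_of_le C0) => w.
    by rewrite leNgt; apply/negP; exact: h.
  (* half of the gap is left for the change of base point, half for [p] *)
  pose m := (f w - (f v + C / 2 * enorm (w - v) ^+ 2)) / 2.
  have m0 : 0 < m by rewrite divr_gt0// subr_gt0.
  have n0 : 0 < enorm (w - v) + 1 by rewrite ltr_wpDl// enorm_ge0.
  have mn0 : 0 < m / (enorm (w - v) + 1) by exact: divr_gt0.
  have cn : enorm (w - v') @[v' --> v] --> enorm (w - v) by exact: enormB_continuous.
  have cf : f v' + C / 2 * enorm (w - v') ^+ 2 @[v' --> v] -->
      f v + C / 2 * enorm (w - v) ^+ 2 by exact: parabola_continuous.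
  have near_f : \forall v' \near v, f v' + C / 2 * enorm (w - v') ^+ 2 < f w - m.
    by apply: (cvgr_lt _ cf); rewrite /m; lra.
  have near_n : \forall v' \near v, enorm (w - v') < enorm (w - v) + 1.
    by apply: (cvgr_lt _ cn); rewrite ltrDl.
  near=> v' delta => p v'p _ /=; rewrite leNgt; apply/negP => pd.
  have d0 : 0 < delta by near: delta; exact: nbhs_right_gt.
  have dm : delta < m / (enorm (w - v) + 1) by near: delta; exact: nbhs_right_lt.
  move: dm; rewrite (ltr_pdivlMr _ _ n0) => dm.
  have h1 : f v' + C / 2 * enorm (w - v') ^+ 2 < f w - m by near: v'.
  have h2 : enorm (w - v') < enorm (w - v) + 1 by near: v'.
  have := superdiff_le C0 sc v'p w; rewrite -/f.
  have := dotv_le p (w - v'); have := enorm_ge0 p; have := enorm_ge0 (w - v').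
  by nra.
move=> near_delta.
have [delta [d0 dP]] : exists delta : R, 0 < delta /\
    [set v : 'rV[R]_d | forall i, `[0, 1]%classic (v ord0 i)] `<=`
   [set v | forall p, superdiff u (toT v) p -> eps <= dist_set (Crit u) (toT v) ->
      delta <= enorm p].
  apply: (@filter_ex _ (0^'+ : set_system R)).
  by apply: filterI; [exact: nbhs_right_gt|exact: near_delta].
exists delta => // x p; have [v <- v01] := toT_cube x; apply: dP => i /=.
by rewrite in_itv/= v01.
Unshelve. all: by end_near. Qed.

End Semiconcave.

(** * Integrating a lower bound on left difference quotients *)

Section LeftDini.
Variable R : realType.
Implicit Types (a b s t : R) (k f : R -> R).

(** If [sigma] is the infimum of the points where [k] does not exceed [k b], the
    right condition puts [sigma] among them, and the left one then forces
    [sigma = a]. *)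
Lemma left_monotone_le k a b : a <= b ->
  (forall t, a <= t < b -> forall e, 0 < e -> \forall s \near t^'+, k t <= k s + e) ->
  (forall t, a < t <= b -> \forall s \near t^'-, k s <= k t) ->
  k a <= k b.
Proof.
move=> ab kr kl; pose S := [set s | a <= s <= b /\ k s <= k b].
have infS : has_inf S.
  by split; [exists b; split=> //; rewrite ab/=|exists a => s [/andP[]]].
have Sb : S b by split=> //; rewrite ab/=.
set sigma := inf S.
have asig : a <= sigma by apply: lb_le_inf; [exists b|move=> s [/andP[]]].
have sigb : sigma <= b by apply: ge_inf => //; exact: infS.2.
have ksig : k sigma <= k b.
  move: sigb; rewrite le_eqVlt => /predU1P[->//|sigb].
  apply/ler_addgt0Pr => e e0.
  have : \forall s \near sigma^'+, k sigma <= k s + e by apply: kr; rewrite // asig.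
  move=> [r /= r0 rP].
  have [s [sab ksb] ssig] := inf_adherent r0 infS.
  have : sigma <= s by apply: ge_inf; [exact: infS.2|].
  rewrite le_eqVlt => /predU1P[->|sigs]; first by rewrite (le_trans ksb)// lerDl ltW.
  apply: (@le_trans _ _ (k s + e)); last by rewrite lerD2r.
  apply: rP => //=; rewrite distrC gtr0_norm ?subr_gt0// ltrBlDl//.
move: asig; rewrite le_eqVlt => /predU1P[->//|asig].
have [r /= r0 rP] : \forall s \near sigma^'-, k s <= k sigma.
  by apply: kl; rewrite asig.
pose s := Num.max a (sigma - r / 2).
have ssig : s < sigma by rewrite /s gt_max asig/= ltrBlDr ltrDl divr_gt0.
have as_ : a <= s by rewrite /s le_max lexx.
suff : sigma <= s by rewrite leNgt ssig.
apply: ge_inf; first exact: infS.2.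
split; first by rewrite as_ (le_trans (ltW ssig)).
apply: le_trans ksig; apply: rP => //=.
rewrite gtr0_norm ?subr_gt0// ltrBlDl -ltrBlDr /s lt_max; apply/orP; right.
by rewrite ltrD2l ltrN2 ltr_pdivrMr// ltr_pMr// ltr1n.
Qed.

Local Notation lam := (@lebesgue_measure R).

Definition occupation (A : set R) t : R := fine (lam (A `&` `[0, t])).

Lemma lam_setI_bounds A (I : set R) r : measurable A -> measurable I ->
  lam I = r%:E -> exists2 q, lam (A `&` I) = q%:E & 0 <= q <= r.
Proof.
move=> mA mI Ir.
have h : (lam (A `&` I) <= r%:E)%E.
  by rewrite -Ir; apply: le_measure; rewrite ?inE//; exact: measurableI.
have fin : lam (A `&` I) \is a fin_num.
  by rewrite ge0_fin_numE// (le_lt_trans h)// ltry.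
by exists (fine (lam (A `&` I))); rewrite ?fineK// -!lee_fin fineK// measure_ge0.
Qed.

Lemma lam_Ioc s t : s <= t -> lam `]s, t] = (t - s)%:E.
Proof.
rewrite lebesgue_measure_itv/= lte_fin; case: ltgtP => // -> _.
by rewrite subrr.
Qed.

Lemma lam_Icc s t : s <= t -> lam `[s, t] = (t - s)%:E.
Proof.
rewrite lebesgue_measure_itv/= lte_fin; case: ltgtP => // -> _.
by rewrite subrr.
Qed.

Lemma occupation_bounds A t : measurable A -> 0 <= t ->
  exists2 r, lam (A `&` `[0%R, t]) = r%:E & 0 <= r <= t.
Proof.
move=> mA t0; have [|r rE] := lam_setI_bounds mA _ (lam_Icc t0); first by [].
by rewrite subr0; exists r.
Qed.

Lemma occupation_split A s t : measurable A -> 0 <= s <= t ->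
  occupation A t = occupation A s + fine (lam (A `&` `]s, t])).
Proof.
move=> mA /andP[s0 st].
have [r1 r1E _] := occupation_bounds mA s0.
have [//|r2 r2E _] := lam_setI_bounds mA _ (lam_Ioc st).
rewrite /occupation r1E r2E/=.
have -> : A `&` `[0, t] = (A `&` `[0, s]) `|` (A `&` `]s, t]).
  rewrite -setIUr; congr setI; apply/seteqP; split => z /=; rewrite !in_itv/=.
    by move=> /andP[z0 zt]; have [zs|zs] := leP z s; [left; rewrite z0|right].
  by move=> [|] /andP[z1 z2]; [rewrite z1 (le_trans z2)|rewrite z2 (le_trans s0)// ltW].
have -> : lam ((A `&` `[0%R, s]) `|` (A `&` `]s, t])) =
    (lam (A `&` `[0%R, s]) + lam (A `&` `]s, t]))%E.
  apply: measureU; [exact: measurableI|exact: measurableI|].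
  apply/seteqP; split => z //= [[_ +] [_ +]]; rewrite !in_itv/= => /andP[_ zs] /andP[sz _].
  by have := le_lt_trans zs sz; rewrite ltxx.
by rewrite r1E r2E.
Qed.

Lemma occupation_incr A s t : measurable A -> 0 <= s <= t ->
  0 <= occupation A t - occupation A s <= t - s.
Proof.
move=> mA st; rewrite (occupation_split mA st) addrAC subrr add0r.
have /andP[_ /lam_Ioc lst] := st.
by have [|r ->] := lam_setI_bounds mA _ lst.
Qed.

Lemma occupation_full A s t : measurable A -> 0 <= s <= t -> `]s, t] `<=` A ->
  occupation A t - occupation A s = t - s.
Proof.
move=> mA st /setIidPr sub; rewrite (occupation_split mA st) addrAC subrr add0r.
by rewrite sub lam_Ioc//; case/andP: st.
Qed.

Lemma occupation_disjoint A s t : measurable A -> 0 <= s <= t -> `]s, t] `<=` ~` A ->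
  occupation A t = occupation A s.
Proof.
move=> mA st sub; rewrite (occupation_split mA st).
rewrite (_ : A `&` _ = set0) ?measure0 ?addr0//.
by apply/seteqP; split => // z [Az /sub].
Qed.

Lemma near_left_itv (V : set R) t : open V -> V t ->
  \forall s \near t^'-, `]s, t] `<=` V.
Proof.
move=> oV Vt; have /nbhs_ballP[r /= r0 rP] : nbhs t V by exact: open_nbhs_nbhs.
exists r => //= s + st z /=; rewrite in_itv/= => tsr /andP[sz zt].
apply: rP; rewrite /ball/= ger0_norm ?subr_ge0//.
apply: le_lt_trans tsr; rewrite ger0_norm ?subr_ge0; last exact: ltW.
by rewrite lerB// ltW.
Qed.

(** The hypothesis on difference quotients is integrated by monotonicity: [f] is
    corrected by the time spent in a small open neighborhood of the null set of
    bad times, and the time spent in [A] is subtracted.  Closedness of [A] makes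
    the latter locally constant off [A], so that each good time involves only one
    of the two lower bounds for the quotients of [f]. *)
Lemma dini_occupation_le f (A : set R) T delta L : 0 < T -> 0 <= delta -> 0 <= L ->
  closed A ->
  (forall t, 0 <= t <= T -> \forall s \near t, 0 <= s -> `|f s - f t| <= L * `|s - t|) ->
  {ae lam, forall t, 0 <= t -> forall e, 0 < e ->
     \forall s \near t^'-, f s + ((if t \in A then delta else 0) - e) * (t - s) <= f t} ->
  delta * occupation A T <= f T - f 0.
Proof.
move=> T0 delta0 L0 cA fL [N [mN N0' NP]].
have N0 : lam N = 0%E by exact: N0'.
have mA : measurable A by exact: closed_measurable.
apply/ler_addgt0Pr => eta eta0.
pose e1 := eta / 2 / (L + delta + 1); pose e2 := eta / 2 / T.
have Ld : 0 < L + delta + 1 by rewrite ltr_wpDl// addr_ge0.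
have e10 : 0 < e1 by rewrite !divr_gt0.
have e20 : 0 < e2 by rewrite !divr_gt0.
have e1E : e1 * (L + delta + 1) = eta / 2 by rewrite /e1 divfK// gt_eqF.
have e2E : e2 * T = eta / 2 by rewrite /e2 divfK// gt_eqF.
have [U [oU NU Ulam]] : exists U : set R,
    [/\ open U, N `<=` U & (lam U <= e1%:E)%E].
  have lN : (lam N < +oo)%E by rewrite N0 ltry.
  have [U [oU NU Ulam]] := lebesgue_regularity_outer mN lN e10.
  exists U; split=> //.
  have mU : measurable U by exact: open_measurable.
  have : (lam (U `\` N `|` N) <= lam (U `\` N) + lam N)%E.
    by apply: measureU2 => //; exact: measurableD.
  by rewrite setDKU// N0 adde0 => /le_trans; apply; exact: ltW.
have mU : measurable U by exact: open_measurable.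
have UT : occupation U T <= e1.
  have [r rE _] := occupation_bounds mU (ltW T0).
  rewrite /occupation rE/= -lee_fin -rE; apply: le_trans Ulam.
  by apply: le_measure; rewrite ?inE//; exact: measurableI.
(* The coefficient [L + delta] makes [k] nondecreasing at the points of [U]:
   [L] compensates [f] and [delta] compensates the term of [A]. *)
pose k t := f t + (L + delta) * occupation U t - delta * occupation A t + e2 * t.
have occ0 B : measurable B -> occupation B 0 = 0.
  move=> mB; have [r rE] := occupation_bounds mB (lexx 0).
  by rewrite /occupation rE/= => r0; apply/eqP; rewrite eq_le andbC.
suff : k 0 <= k T.
  rewrite /k !occ0// !mulr0 !subr0 !addr0 e2E.
  have : (L + delta) * occupation U T <= (L + delta) * e1 by rewrite ler_wpM2l// addr_ge0.
  by nra.
apply: left_monotone_le (ltW T0) _ _ => [t /andP[t0 tT] e e0|t /andP[t0 tT]].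
  near=> s.
  have ts : t < s by near: s; exact: nbhs_right_gt.
  have st : s < t + e / (L + delta + 1).
    by near: s; apply: nbhs_right_lt; rewrite ltrDl divr_gt0.
  have : 0 <= s -> `|f s - f t| <= L * `|s - t|.
    by near: s; apply: cvg_at_right_filter; [exact: cvg_id|apply: fL; rewrite t0 ltW].
  rewrite (le_trans t0 (ltW ts)) (gtr0_norm (x := s - t)) ?subr_gt0// ler_norml.
  move=> /(_ isT)/andP[fst _].
  have tsb : 0 <= t <= s by rewrite t0 ltW.
  have /andP[U1 _] := occupation_incr mU tsb.
  have /andP[A1 A2] := occupation_incr mA tsb.
  rewrite -ltrBlDl ltr_pdivlMr// in st.
  by rewrite /k; nra.
have nearU : U t -> \forall s \near t^'-, `]s, t] `<=` U by exact: near_left_itv.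
have nearA : t \notin A -> \forall s \near t^'-, `]s, t] `<=` ~` A.
  by rewrite notin_setE; apply: near_left_itv; exact: closed_openC.
have nearP : ~ U t -> \forall s \near t^'-,
    f s + ((if t \in A then delta else 0) - e2) * (t - s) <= f t.
  move=> Ut; apply: contrapT => h; apply: Ut; apply: NU; apply: NP.
  by move=> /(_ (ltW t0) _ e20).
have nearL : \forall s \near t^'-, 0 <= s -> `|f s - f t| <= L * `|s - t|.
  by apply: cvg_at_left_filter; [exact: cvg_id|apply: fL; rewrite tT ltW].
have common : \forall s \near t^'-,
    [/\ s < t, 0 < s & (0 <= s -> `|f s - f t| <= L * `|s - t|)].
  by near=> s; split; near: s; [exact: nbhs_left_lt|exact: nbhs_left_gt|].
have incr s : 0 < s -> s < t -> 0 <= s <= t by move=> s0 st; rewrite !ltW.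
have [Ut|Ut] := pselect (U t).
  apply: filterS2 (nearU Ut) common => s sU [st s0 /(_ (ltW s0))].
  rewrite (distrC s) (gtr0_norm (x := t - s)) ?subr_gt0// ler_norml => /andP[_ fst].
  have stb := incr _ s0 st.
  have /andP[A1 A2] := occupation_incr mA stb.
  have -> : k t = f t + (L + delta) * (occupation U s + (t - s))
      - delta * occupation A t + e2 * t.
    by rewrite /k -(occupation_full mU stb sU) [_ + (_ - _)]addrC subrK.
  by rewrite /k; nra.
have [tA|tA] := boolP (t \in A).
  apply: filterS2 (nearP Ut) common => s; rewrite tA => Ps [st s0 _].
  have stb := incr _ s0 st.
  have /andP[A1 A2] := occupation_incr mA stb.
  have /andP[U1 _] := occupation_incr mU stb.
  by rewrite /k; nra.
apply: filterS3 (nearA tA) (nearP Ut) common => s sA; rewrite (negbTE tA) => Ps [st s0 _].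
have stb := incr _ s0 st.
have /andP[U1 _] := occupation_incr mU stb.
by rewrite /k (occupation_disjoint mA stb sA); nra.
Unshelve. all: by end_near. Qed.

End LeftDini.

(** * Gain of height along the flow *)

Section GradientFlow.
Variables (R : realType) (d : nat).
Implicit Types (u : torus R d -> R) (c : R -> torus R d) (p : 'rV[R]_d) (t T : R).

Lemma is_derive_near_left (g : R -> 'rV[R]_d) (t : R) p e : is_derive t 1 g p -> 0 < e ->
  \forall s \near t^'-, enorm (g s - g t - (s - t) *: p) <= e * (t - s).
Proof.
move=> [gt <-] e0.
have [r /= r0 rP] : \forall h \near 0^',
    enorm (h^-1 *: ((g \o shift t) (h *: 1) - g t) - 'D_1 g t) < e.
  exact: (gt _ (near_enorm_lt _ e0)).
exists r => //= s; rewrite /= => str st.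
have st0 : s - t < 0 by rewrite subr_lt0.
have := rP (s - t); rewrite /= sub0r normrN distrC str lt_eqF// => /(_ isT isT).
rewrite /= [_ *: 1]mulr1 subrK => h.
have -> : g s - g t - (s - t) *: 'D_1 g t =
    (s - t) *: ((s - t)^-1 *: (g s - g t) - 'D_1 g t).
  by rewrite scalerBr scalerA mulfV ?lt_eqF// scale1r.
rewrite enormZ ltr0_norm// opprB mulrC ler_wpM2r ?subr_ge0 ?ltW//.
Qed.

(** Reading the superdifferential inequality at [c t] backwards in time,
    where it is a lower bound for the gain of [u]. *)
Lemma energy_left u C c (t : R) p e : 0 <= C -> semiconcave_with C u ->
  superdiff u (c t) p -> has_velocity c t p -> 0 < e ->
  \forall s \near t^'-, u (c s) + (enorm p ^+ 2 - e) * (t - s) <= u (c t).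
Proof.
move=> C0 sc ctp [g gc gp] e0.
have gtE : toT (g t) = c t by exact: (nbhs_singleton gc).
rewrite -gtE in ctp.
pose P := enorm p; have P0 : 0 <= P by exact: enorm_ge0.
(* [e / 2] pays for the error [<p, q>] of the linear approximation of the lift,
   the other [e / 2] for the quadratic term. *)
pose e1 := e / 2 / (P + 1).
have P1 : 0 < P + 1 by rewrite ltr_wpDl.
have e10 : 0 < e1 by rewrite !divr_gt0.
have e1E : e1 * (P + 1) = e / 2 by rewrite /e1 divfK// gt_eqF.
pose K := C / 2 * (P + e1) ^+ 2; have K0 : 0 <= K by rewrite mulr_ge0 ?sqr_ge0// divr_ge0.
have K1 : 0 < K + 1 by rewrite ltr_wpDl.
have r0 : 0 < e / 2 / (K + 1) by rewrite !divr_gt0.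
have near_g := is_derive_near_left gp e10.
near=> s.
have st : s < t by near: s; exact: nbhs_left_lt.
have sE : toT (g s) = c s by near: s; exact: (cvg_at_left_filter cvg_id).
have gs : enorm (g s - g t - (s - t) *: p) <= e1 * (t - s) by near: s.
have sr : t - s < e / 2 / (K + 1) by near: s; exact: nbhs_left_ltBl.
rewrite (ltr_pdivlMr _ _ K1) in sr.
have := superdiff_le C0 sc ctp (g s); rewrite /periodic_ext gtE sE.
set q := g s - g t - (s - t) *: p in gs.
have -> : g s - g t = q + (s - t) *: p by rewrite /q subrK.
rewrite dotvDr dotvZr -sqr_enorm -/P.
have := dotv_le p q; rewrite -/P.
have : enorm (q + (s - t) *: p) <= (P + e1) * (t - s).
  apply: (le_trans (ler_enormD _ _)); rewrite enormZ distrC gtr0_norm ?subr_gt0//.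
  by rewrite -/P; move: gs; rewrite -/q; lra.
have := enorm_ge0 (q + (s - t) *: p); have := enorm_ge0 q.
set n := enorm (q + _); set m := enorm q in gs *; set h := t - s in gs sr *.
have -> : s - t = - h by rewrite opprB.
have h0 : 0 < h by rewrite subr_gt0.
move=> m0 n0 nh dq H.
have n2 : C / 2 * n ^+ 2 <= K * h ^+ 2.
  rewrite /K -[leRHS]mulrA -exprMn ler_wpM2l ?divr_ge0//.
  by rewrite ler_pXn2r// nnegrE// mulr_ge0 ?(ltW h0)// addr_ge0// ltW.
have dq2 : dotv p q <= e / 2 * h.
  apply: (le_trans dq); rewrite -e1E.
  by nra.
have Kh : K * h ^+ 2 <= e / 2 * h.
  by rewrite expr2 mulrA ler_wpM2r ?(ltW h0)//; nra.
by nra.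
Unshelve. all: by end_near. Qed.

Lemma torus_lip u c K : 0 <= K ->
  (forall v w, periodic_ext u v - periodic_ext u w <= K * enorm (v - w)) ->
  forall x y, `|u x - u y| <= K * torus_dist x y.
Proof.
move=> K0 lip.
have half x y : u x - u y <= K * torus_dist x y.
  apply/ler_addgt0Pr => e e0.
  have e10 : 0 < e / (K + 1) by rewrite divr_gt0// ltr_wpDl.
  have [v [w [vx wy vw]]] := torus_dist_adherent x y e10.
  have := lip v w; rewrite /periodic_ext vx wy => h; apply: (le_trans h).
  apply: (@le_trans _ _ (K * (torus_dist x y + e / (K + 1)))).
    by rewrite ler_wpM2l// ltW.
  rewrite mulrDr lerD2l mulrCA ger_pMr// ler_pdivrMr ?ltr_wpDl// mul1r.
  by rewrite lerDl.
move=> x y; rewrite ler_norml half andbT lerNl opprB torus_distC; exact: half.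
Qed.

(** The quantifiers are exchanged by compactness of [[0, T]]: one constant [L]
    for all times, at the price of a neighborhood depending on the time. *)
Lemma locally_lipschitz_compact c T : 0 <= T -> locally_lipschitz c ->
  exists2 L, 0 <= L & forall t, 0 <= t <= T -> \forall s \near t, 0 <= s ->
    torus_dist (c s) (c t) <= L * `|s - t|.
Proof.
move=> T0 cL.
have : \forall L \near +oo, `[0, T] `<=` [set t : R | 0 <= t -> \forall s \near t,
    0 <= s -> torus_dist (c s) (c t) <= L * `|s - t|].
  have /compact_near_coveringP := @segment_compact R 0 T; apply => t0.
  rewrite /= in_itv/= => /andP[t00 _].
  have [r [L [r0 rL]]] := cL _ t00.
  near=> t L' => tge0.
  have tt0 : ball t0 r t by near: t; exact: nbhsx_ballx.
  rewrite /ball/= distrC in tt0.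
  have LL' : L <= L' by near: L'; apply: nbhs_pinfty_ge; exact: num_real.
  near=> s => s0; apply: (@le_trans _ _ (L * `|s - t|)).
    apply: rL => //; rewrite distrC.
    have : ball t (r - `|t - t0|) s by near: s; apply: nbhsx_ballx; rewrite subr_gt0.
    rewrite /ball/= ltrBrDr => h; apply: le_lt_trans h.
    by rewrite distrC (distrC t s) ler_distD.
  by rewrite ler_wpM2r.
move=> near_L.
have [L [L0 LP]] : exists L : R, 0 <= L /\ `[0, T] `<=` [set t : R | 0 <= t ->
    \forall s \near t, 0 <= s -> torus_dist (c s) (c t) <= L * `|s - t|].
  apply: (@filter_ex _ (+oo : set_system R)).
  by apply: filterI => //; apply: nbhs_pinfty_ge; exact: num_real.
exists L => // t t0T; apply: LP; last by case/andP: t0T.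
by rewrite /= in_itv.
Unshelve. all: by end_near. Qed.

Lemma closed_far_times S c T eps : locally_lipschitz c ->
  closed [set t : R | 0 <= t <= T /\ eps <= dist_set S (c t)].
Proof.
move=> cL; rewrite -[X in closed X]setCK; apply: open_closedC.
rewrite openE => t /= nt; rewrite /interior.
have [t0|t0] := ltP t 0.
  near=> s => -[/andP[s0 _] _]; move: s0; rewrite leNgt => /negP; apply.
  by near: s; exact: lt_nbhsl.
have [tT|tT] := ltP T t.
  near=> s => -[/andP[_ sT] _]; move: sT; rewrite leNgt => /negP; apply.
  by near: s; exact: lt_nbhsr.
have dt : dist_set S (c t) < eps.
  by rewrite ltNge; apply/negP => h; apply: nt; rewrite t0 tT.
have [r [L [r0 rL]]] := cL _ t0.
have L1 : 0 < `|L| + 1 by rewrite ltr_wpDl.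
near=> s => -[/andP[s0 _]]; apply/negP; rewrite -ltNge.
apply: (le_lt_trans (dist_set_lip S (c s) (c t))); rewrite -ltrBrDr.
have st : ball t (Num.min r ((eps - dist_set S (c t)) / (`|L| + 1))) s.
  by near: s; apply: nbhsx_ballx; rewrite lt_min r0 divr_gt0// subr_gt0.
move: st; rewrite /ball/= distrC lt_min (ltr_pdivlMr _ _ L1) => /andP[str ste].
apply: (le_lt_trans (rL s t s0 t0 str _)); first by rewrite subrr normr0.
apply: le_lt_trans ste; rewrite mulrC ler_wpM2l//.
by rewrite (le_trans (ler_norm L))// lerDl.
Unshelve. all: by end_near. Qed.

(** [2 * M] bounds the oscillation of [u] and [delta ^+ 2] the rate of increase
    of [u] at the far times. *)
Lemma far_times_bounded u x c eps : semiconcave u -> gradient_flow u x c -> 0 < eps ->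
  exists D : R, forall T, 0 < T ->
    (lebesgue_measure [set t : R | (0 <= t <= T)%R /\ (eps <= dist_set (Crit u) (c t))%R]
       <= D%:E)%E.
Proof.
move=> [uc [C Cgt0 sc]] [_ cL flow] eps0.
have C0 := ltW Cgt0.
have [M M0 uM] := torus_bounded uc.
have K0 : 0 <= 2 * M + C / 2 by rewrite addr_ge0 ?mulr_ge0 ?divr_ge0.
have ulip := torus_lip c K0 (semiconcave_lip C0 uM sc).
have [delta delta0 deltaP] := superdiff_away_Crit uc C0 sc eps0.
have delta20 : 0 < delta ^+ 2 by rewrite exprn_gt0.
exists (2 * M / delta ^+ 2) => T T0.
set A := [set t | _].
have cA : closed A by exact: closed_far_times.
have mA : measurable A by exact: closed_measurable.
have [L L0 LP] := locally_lipschitz_compact (ltW T0) cL.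
have fL t : 0 <= t <= T -> \forall s \near t, 0 <= s ->
    `|u (c s) - u (c t)| <= (2 * M + C / 2) * L * `|s - t|.
  move=> /LP; apply: filterS => s h s0; apply: (le_trans (ulip _ _)).
  by rewrite -mulrA ler_wpM2l// h.
have : delta ^+ 2 * occupation A T <= u (c T) - u (c 0).
  apply: (dini_occupation_le (f := u \o c) T0 (ltW delta20) (mulr_ge0 K0 L0) cA fL).
  have aeF := ae_filter_ringOfSetsType (@lebesgue_measure R).
  apply: (@filterS _ _ aeF _ _ _ flow) => t h t0 e e0; have [p up vp] := h t0.
  apply: filterS2 (energy_left C0 sc up vp e0) (nbhs_left_lt t) => s /= h1 st.
  apply: le_trans h1; rewrite lerD2l ler_wpM2r ?subr_ge0 ?(ltW st)// lerD2r.
  case: ifPn => [/set_mem[_ /(deltaP _ _ up)]|_]; last by rewrite sqr_ge0.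
  by move=> dp; rewrite ler_pXn2r// nnegrE ?enorm_ge0 ?ltW.
have [r rE _] := occupation_bounds mA (ltW T0).
have -> : lebesgue_measure A = r%:E.
  by rewrite -rE setIidl// => t [+ _]; rewrite /= in_itv.
rewrite /occupation rE/= lee_fin ler_pdivlMr// mulrC => h; apply: (le_trans h).
have := uM (c T); have := uM (c 0); rewrite !ler_norml; lra.
Qed.

End GradientFlow.

(** * The averaged time away from the critical set *)

Theorem theorem6 (R : realType) (d : nat) (u : torus R d -> R)
    (x : torus R d) (c : R -> torus R d) (eps : R) :
  semiconcave u ->
  gradient_flow u x c ->
  0 < eps ->
  ((T^-1)%R%:E * lebesgue_measure
     [set t : R | (0 <= t <= T)%R /\ (eps <= dist_set (Crit u) (c t))%R])%E
    @[T --> +oo%R] --> 0%E.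
Proof.
move=> usc flow eps0; have [D DP] := far_times_bounded usc flow eps0.
apply: (@squeeze_cvge _ _ _ _ (cst 0%E) _ (fun T : R => (T^-1 * D)%:E)).
- near=> T; have T0 : 0 < T by near: T; apply: nbhs_pinfty_gt; exact: num_real.
  apply/andP; split; first by rewrite mule_ge0// lee_fin invr_ge0 ltW.
  by rewrite EFinM lee_wpmul2l// ?DP// lee_fin invr_ge0 ltW.
- exact: cvg_cst.
apply: cvg_EFin; first by near=> T.
have inv0 : T^-1 @[T --> +oo%R] --> (0 : R).
  by apply/gtr0_cvgV0; [exact: nbhs_pinfty_gt|exact: cvg_id].
have := cvgM inv0 (cvg_cst D); rewrite mul0r; exact.
Unshelve. all: by end_near. Qed.
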